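(* Let $N\ge 1$, let $\Omega\subseteq\mathbb{R}^N$ be a nonempty (possibly unbounded) open set and let $p\in(2,2^* )$. Then the negative of the energy ground state level $\mathcal{E}$ is the Legendre--Fenchel transform of the action ground state level $\mathcal{J}$, that is, $$-\mathcal{E}(\mu)=\mathcal{J}^*(\mu):=\sup_{\lambda\in\mathbb{R}}\bigl(\lambda\mu-\mathcal{J}(\lambda)\bigr)\qquad\text{for every }\mu\ge 0,$$ as an identity in $(-\infty,+\infty]$ (both sides may be $+\infty$).
   Context: Here $2^*=\frac{2N}{N-2}$ if $N\ge3$ and $2^*=+\infty$ if $N=1,2$; $\|\cdot\|_q$ is the norm of $L^q(\Omega)$; functions are real-valued. For $\lambda\in\mathbb{R}$ and $u\in H_0^1(\Omega)$, the action functional is $J_\lambda(u)=\frac12\|\nabla u\|_2^2+\frac\lambda2\|u\|_2^2-\frac1p\|u\|_p^p$ and the energy functional is $E(u)=\frac12\|\nabla u\|_2^2-\frac1p\|u\|_p^p$. The Nehari manifold is $\mathcal{N}_\lambda=\{u\in H_0^1(\Omega)\setminus\{0\}:\ \|\nabla u\|_2^2+\lambda\|u\|_2^2=\|u\|_p^p\}$. The mass-constrained space is $\mathcal{M}_\mu=\{u\in H_0^1(\Omega):\ \frac12\|u\|_2^2=\mu\}$ for $\mu\ge0$. The action ground state level is $\mathcal{J}(\lambda)=\inf_{v\in\mathcal{N}_\lambda}J_\lambda(v)$ (which is $\ge 0$) and the energy ground state level is $\mathcal{E}(\mu)=\inf_{v\in\mathcal{M}_\mu}E(v)\in[-\infty,+\infty)$.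 No attainment of the infima is assumed. *)

(* Defs.v *)
From HB Require Import structures.
From mathcomp Require Import all_boot all_order all_algebra.
From mathcomp Require Import all_classical all_reals all_analysis.

Set Implicit Arguments.
Unset Strict Implicit.
Unset Printing Implicit Defensive.

Import Order.TTheory GRing.Theory Num.Theory.
Import numFieldNormedType.Exports.

Local Open Scope classical_set_scope.
Local Open Scope ring_scope.

(* The sigma-algebra on R^n generated by the coordinates, that is, the Borel
   sigma-algebra. *)
Section measurable_rV.
Context {R : realType} {n : nat}.

Definition rV_coord (i : 'I_n) (x : 'rV[R]_n) : measurableTypeR R := x ord0 i.

Let rV_set0 : g_sigma_preimage rV_coord set0.
Proof. exact: sigma_algebra0. Qed.

Let rV_setC A : g_sigma_preimage rV_coord A -> g_sigma_preimage rV_coord (~` A).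
Proof. exact: sigma_algebraC. Qed.

Let rV_bigcup (F : _^nat) : (forall i, g_sigma_preimage rV_coord (F i)) ->
  g_sigma_preimage rV_coord (\bigcup_i (F i)).
Proof. exact: sigma_algebra_bigcup. Qed.

HB.instance Definition _ := @isMeasurable.Build default_measure_display
  'rV[R]_n (g_sigma_preimage rV_coord) rV_set0 rV_setC rV_bigcup.

Lemma measurable_rV_coord i : measurable_fun setT (rV_coord i).
Proof.
move=> _ Y mY; rewrite setTI; apply: sub_sigma_algebra => /=.
rewrite -bigcup_seq/=; exists i => /=; first by rewrite mem_index_enum.
by exists Y => //; rewrite setTI.
Qed.

Lemma measurable_fun_rV_coordP d (T : measurableType d) (f : T -> 'rV[R]_n) :
  (forall i, measurable_fun setT (rV_coord i \o f)) -> measurable_fun setT f.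
Proof.
move=> mf; suff H : g_sigma_preimage (fun i => rV_coord i \o f) `<=` measurable.
  rewrite g_sigma_preimage_comp in H.
  by move=> _ A mA; apply: H; exists A.
apply: smallest_sub; first exact: sigma_algebra_measurable.
move=> A; rewrite -bigcup_seq => -[/= i _ [B mB <-]].
by have /= := mf i; apply.
Qed.

End measurable_rV.

Section lebesgue_rV.
Context {R : realType}.

Definition cons_rV n (p : measurableTypeR R * 'rV[R]_n) : 'rV[R]_n.+1 :=
  \row_i (if unlift ord0 i is Some j then p.2 ord0 j else p.1).

Definition uncons_rV n (x : 'rV[R]_n.+1) : measurableTypeR R * 'rV[R]_n :=
  (x ord0 ord0, \row_j x ord0 (lift ord0 j)).

Lemma cons_rVK n : cancel (@cons_rV n) (@uncons_rV n).
Proof.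
move=> [t x]; rewrite /uncons_rV /cons_rV mxE unlift_none; congr pair.
by apply/rowP => j; rewrite !mxE liftK.
Qed.

Lemma measurable_cons_rV n : measurable_fun setT (@cons_rV n).
Proof.
apply: measurable_fun_rV_coordP => i; case: (unliftP ord0 i) => [j|] ->.
  rewrite (_ : _ \o _ = rV_coord j \o snd).
    exact: measurableT_comp (measurable_rV_coord j) measurable_snd.
  by apply/funext => p; rewrite /= /rV_coord mxE liftK.
rewrite (_ : _ \o _ = fst) //.
by apply/funext => p; rewrite /= /rV_coord mxE unlift_none.
Qed.

Lemma measurable_uncons_rV n : measurable_fun setT (@uncons_rV n).
Proof.
apply/measurable_fun_pairP; split; first exact: (measurable_rV_coord ord0).
apply: measurable_fun_rV_coordP => i.
rewrite (_ : _ \o _ = rV_coord (lift ord0 i)); first exact: measurable_rV_coord.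
by apply/funext => x; rewrite /rV_coord /= mxE.
Qed.

Section cons_measure.
Variables (n : nat) (m : {sigma_finite_measure set 'rV[R]_n -> \bar R}).

Definition cons_measure : set 'rV[R]_n.+1 -> \bar R :=
  pushforward (lebesgue_measure \x m)%E (@cons_rV n).

Let cons_measure0 : cons_measure set0 = 0%E.
Proof. by rewrite /cons_measure /pushforward preimage_set0 measure0. Qed.

Let cons_measure_ge0 A : (0 <= cons_measure A)%E.
Proof. exact: (measure_ge0 (lebesgue_measure \x m)%E). Qed.

Let cons_measure_sigma_additive : semi_sigma_additive cons_measure.
Proof.
have mc := @measurable_cons_rV n; rewrite /cons_measure.
exact: measure_semi_sigma_additive.
Qed.

HB.instance Definition _ := isMeasure.Build _ _ _ cons_measure
  cons_measure0 cons_measure_ge0 cons_measure_sigma_additive.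

Let cons_measure_sigma_finite : sigma_finite setT cons_measure.
Proof.
have /sigma_finiteP[F [FT ndF Foo]] :=
  @sigma_finiteT _ _ _ (@lebesgue_measure R).
have /sigma_finiteP[G [GT ndG Goo]] := sigma_finiteT m.
exists (fun k => @uncons_rV n @^-1` (F k `*` G k)).
  apply/esym; rewrite -subTset => x _.
  have [i _ Fi] : (\bigcup_i F i) (uncons_rV x).1 by rewrite -FT.
  have [j _ Gj] : (\bigcup_i G i) (uncons_rV x).2 by rewrite -GT.
  exists (maxn i j) => //; split.
    by move: (Fi); exact/subsetPset/ndF/leq_maxl.
  by move: (Gj); exact/subsetPset/ndG/leq_maxr.
move=> k; have [mF Fk] := Foo k; have [mG Gk] := Goo k; split.
  rewrite -[X in measurable X]setTI; apply: measurable_uncons_rV => //.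
  exact: measurableX.
rewrite /cons_measure /pushforward -comp_preimage.
rewrite (_ : _ \o _ = id); last by apply/funext => p; exact: cons_rVK.
rewrite preimage_id product_measure1E//.
by rewrite lte_mul_pinfty// ge0_fin_numE.
Qed.

HB.instance Definition _ := Measure_isSigmaFinite.Build _ _ _ cons_measure
  cons_measure_sigma_finite.

End cons_measure.

(* n-dimensional Lebesgue measure, as the n-fold product of the measure on the
   line. It lives on Borel sets; replacing them by Lebesgue sets does not change
   the L^q spaces up to equality almost everywhere. *)
Fixpoint lebesgue_rV n : {sigma_finite_measure set 'rV[R]_n -> \bar R} :=
  match n with
  | 0 => \d_(0 : 'rV[R]_0)
  | n.+1 => cons_measure (lebesgue_rV n)
  end.

End lebesgue_rV.

Section sobolev.
Context {R : realType} {N : nat}.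
Local Notation Rn := 'rV[R]_N.
Local Notation leb := (lebesgue_rV N).
Implicit Types (Omega : set Rn) (f : Rn -> R) (i : 'I_N).

Definition partial i f : Rn -> R := 'D_(delta_mx ord0 i) f.

Fixpoint Ck k f : Prop :=
  continuous f /\
  if k is k'.+1 then
    forall i, (forall x, derivable f x (delta_mx ord0 i)) /\ Ck k' (partial i f)
  else True.

Definition support f : set Rn := closure [set x | f x != 0].

Definition test_function Omega f : Prop :=
  [/\ forall k, Ck k f, compact (support f) & support f `<=` Omega].

Definition in_L2 Omega f : Prop := f \_ Omega \in Lfun leb 2%:E.

(* [fine] sends an infinite norm to 0. Every norm used below is finite: those of
   exponent 2 because the functions are in L^2(Omega), those of exponent p
   because H^1_0(Omega) embeds in L^p(Omega) for 2 < p < 2^*. *)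
Definition Lq_norm Omega (q : R) f : R :=
  fine ('N[leb]_q%:E[EFin \o (f \_ Omega)]).

(* An element of H^1(Omega) is bundled with its weak gradient, which is unique
   up to equality almost everywhere. *)
Record H1 Omega := MkH1 {
  H1_fun :> Rn -> R;
  H1_grad : 'I_N -> Rn -> R;
  H1_fun_L2 : in_L2 Omega H1_fun;
  H1_grad_L2 : forall i, in_L2 Omega (H1_grad i);
  H1_gradP : forall i phi, test_function Omega phi ->
    \int[leb]_(x in Omega) (H1_fun x * partial i phi x) =
    - \int[leb]_(x in Omega) (H1_grad i x * phi x) }.

(* The closure of the test functions for the H^1 norm. *)
Definition H10 Omega : set (H1 Omega) :=
  [set u : H1 Omega | exists phi : nat -> Rn -> R,
    [/\ forall k, test_function Omega (phi k),
        Lq_norm Omega 2 (phi k \- u) @[k --> \oo] --> (0 : R) &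
        forall i, Lq_norm Omega 2 (partial i (phi k) \- H1_grad u i)
          @[k --> \oo] --> (0 : R)]].

Definition grad_norm Omega (u : H1 Omega) : R :=
  Lq_norm Omega 2 (fun x => Num.sqrt (\sum_i H1_grad u i x ^+ 2)).

Definition energy Omega (p : R) (u : H1 Omega) : R :=
  2^-1 * grad_norm u ^+ 2 - p^-1 * Lq_norm Omega p u `^ p.

Definition action Omega (p lambda : R) (u : H1 Omega) : R :=
  2^-1 * grad_norm u ^+ 2 + lambda / 2 * Lq_norm Omega 2 u ^+ 2
    - p^-1 * Lq_norm Omega p u `^ p.

Definition nehari Omega (p lambda : R) : set (H1 Omega) :=
  [set u : H1 Omega | [/\ H10 u, ~ (H1_fun u = cst 0 %[ae leb in Omega]) &
    grad_norm u ^+ 2 + lambda * Lq_norm Omega 2 u ^+ 2 = Lq_norm Omega p u `^ p]].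

Definition mass_constrained Omega (mu : R) : set (H1 Omega) :=
  [set u : H1 Omega | H10 u /\ 2^-1 * Lq_norm Omega 2 u ^+ 2 = mu].

Definition action_level Omega (p lambda : R) : \bar R :=
  ereal_inf [set (action p lambda v)%:E | v in @nehari Omega p lambda].

Definition energy_level Omega (p mu : R) : \bar R :=
  ereal_inf [set (energy p v)%:E | v in @mass_constrained Omega mu].

End sobolev.

Definition critical_exponent (R : realType) (N : nat) : \bar R :=
  if (3 <= N)%N then ((2 * N)%N%:R / (N - 2)%N%:R)%:E else +oo%E.

Definition legendre_fenchel (R : realType) (f : R -> \bar R) (mu : R) : \bar R :=
  ereal_sup [set ((lambda * mu)%:E - f lambda)%E | lambda in [set: R]].

(* Main.v *)
Require Import Defs.
From mathcomp Require Import all_boot all_order all_algebra.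
From mathcomp Require Import all_classical all_reals all_analysis.
From mathcomp Require Import measurable_realfun lra ring.
Import Order.TTheory GRing.Theory Num.Theory.
Import numFieldNormedType.Exports.

Set Implicit Arguments.
Unset Strict Implicit.
Unset Printing Implicit Defensive.

Local Open Scope classical_set_scope.
Local Open Scope ring_scope.

(** The duality is elementary once two facts about rays are available. Along a
ray c |-> c v, all the functionals involved are homogeneous: squared L^2 norms
and Dirichlet terms scale by c^2, the L^p term by c^p.

- If v lies on the Nehari manifold of lambda, then c = 1 maximizes the action
  along the ray ([nehari_action_max]), which amounts to the inequality
  c^2/2 - c^p/p <= 1/2 - 1/p. Rescaling v to mass mu can thus only lower the
  action, and at mass mu the action is the energy plus lambda mu. Hence
  E(mu) + lambda mu <= J(lambda) ([energy_le_action]), and taking the supremum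
  over lambda gives J^*(mu) <= - E(mu).
- Conversely every v with nonzero L^2 norm lies on the Nehari manifold of
  exactly one lambda, its [nehari_multiplier]. If v has mass mu > 0, this lambda
  gives J(lambda) <= E(v) + lambda mu, so - E(v) <= J^*(mu)
  ([legendre_ge_action]).

The case mu = 0 of the second step is different, because a massless v is on no
Nehari manifold. Its energy is nonnegative ([energy_ge0_massless]), so the claim
becomes 0 <= J^*(0), that is inf J <= 0. Shrinking one fixed nonzero function u
works: on the Nehari manifold the action of c u is (1/2 - 1/p) c^p ||u||_p^p,
which tends to 0 with c ([legendre0_ge0]).

The L^p term enters only through its sign and its homogeneity, and [Lq_norm] is
homogeneous on all measurable functions: sending an infinite norm to 0 commutes
with scaling ([Lq_normZ]).

What has to be built by hand is a nonzero element of H^1_0(Omega). It is a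
product of one-dimensional bumps made from exp(-1/t). Such a product is C^k for
every k because each partial derivative is again a product of the same kind
([Ck_prod_coord]); its classical gradient is a weak gradient by integration by
parts ([test_integration_by_parts]), which reduces to the vanishing of the
integral of a partial derivative of a C^1 function supported in a cube
([integral_partial_eq0], by Fubini and the fundamental theorem of calculus). *)

(** * Borel sets and cubes in R^n *)

Section continuous_measurable.
Context {R : realType}.

Lemma ball_rVE n (x y : 'rV[R]_n) (e : R) : 0 < e ->
  ball x e y <-> forall i, `|x ord0 i - y ord0 i| < e.
Proof.
move=> e0; split => [xy i|xy].
  by case: xy => _ /(_ ord0 i).
by split=> // i j; rewrite (ord1 i); exact: xy.
Qed.

Lemma measurable_ball_rV n (x : 'rV[R]_n) (e : R) : 0 < e -> measurable (ball x e).
Proof.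
move=> e0.
rewrite (_ : ball x e =
  \big[setI/setT]_(i < n) (rV_coord i @^-1` ball (x ord0 i) e)).
  apply: bigsetI_measurable => i _; rewrite -[X in measurable X]setTI.
  by apply: measurable_rV_coord => //; exact: measurable_ball.
apply/seteqP; split => y.
  by move/(ball_rVE _ _ e0) => xy; rewrite -bigcap_seq => i _ /=; exact: xy.
rewrite -bigcap_seq => xy; apply/(ball_rVE _ _ e0) => i.
by apply: (xy i) => /=; rewrite mem_index_enum.
Qed.

(** The rational balls with radius 1/(k+1) are countably many, and those inside
an open set cover it; each is a finite intersection of coordinate preimages. *)
Lemma open_measurable_rV n (U : set 'rV[R]_n) : open U -> measurable U.
Proof.
move=> oU.
pose F (z : 'rV[rat]_n * nat) : set 'rV[R]_n :=
  ball (map_mx ratr z.1 : 'rV[R]_n) (z.2.+1%:R^-1).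
pose G z := if `[< F z `<=` U >] then F z else set0.
rewrite (_ : U = \bigcup_k (if unpickle k is Some z then G z else set0)).
  apply: bigcup_measurable => k _; case: (unpickle k) => // z.
  by rewrite /G; case: ifP => // _; exact: measurable_ball_rV.
apply/seteqP; split => [x Ux|x [k _]]; last first.
  case: (unpickle k) => // z; rewrite /G.
  by case: asboolP => [zU zx|_ []]; exact: zU.
have /nbhs_ballP[e /= e0 eU] : nbhs x U by exact: open_nbhs_nbhs.
have [k ke] : exists k : nat, k.+1%:R^-1 < e / 2.
  have [k _ ke] := near_infty_natSinv_lt (PosNum (divr_gt0 e0 (ltr0Sn R 1))).
  by exists k; exact: (ke k (leqnn k)).
have k0 : 0 < k.+1%:R^-1 :> R by rewrite invr_gt0.
have q_ i : exists q : rat, `|x ord0 i - ratr q| < k.+1%:R^-1 :> R.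
  have [|q] := @rat_in_itvoo R (x ord0 i - k.+1%:R^-1) (x ord0 i + k.+1%:R^-1).
    by rewrite ltrD2l gtrN.
  by rewrite in_itv/= => /andP[q1 q2]; exists q; rewrite distrC ltr_distl q1 q2.
have [q qE] : exists q : 'rV[rat]_n,
    forall i, `|x ord0 i - ratr (q ord0 i)| < k.+1%:R^-1.
  have [q qE] := choice q_; exists (\row_i q i) => i; rewrite mxE; exact: qE.
exists (pickle (q, k)) => //; rewrite pickleK /G asboolT.
  by apply/ball_rVE => // i; rewrite mxE distrC; exact: qE.
move=> y /(ball_rVE _ _ k0)/= qy; apply: eU; apply/ball_rVE => // i.
have := qy i; rewrite mxE => qyi.
rewrite (le_lt_trans (ler_distD (ratr (q ord0 i)) _ _))// [ltRHS]splitr.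
by rewrite ltrD// (lt_trans _ ke)//; exact: qE.
Qed.

Lemma continuous_measurable_rV n (f : 'rV[R]_n -> R) :
  continuous f -> measurable_fun setT f.
Proof.
move=> /continuousP cf; apply: (measurability _ (RGenOpens.measurableE R)).
move=> _ [_ [a [b ->] <-]]; rewrite setTI.
have oab : open `]a, b[%classic by exact: interval_open.
exact: open_measurable_rV (cf _ oab).
Qed.

End continuous_measurable.

Section cubes.
Context {R : realType}.

(** Cubes are at once the compact sets that exhaust R^n, the sets of known
finite measure, and sets adapted to peeling off one coordinate. *)
Definition cube n (a : 'rV[R]_n) (r : R) : set 'rV[R]_n :=
  [set x | forall i, `|x ord0 i - a ord0 i| <= r].

Lemma cube_compact n (a : 'rV[R]_n) (r : R) : compact (cube a r).
Proof.
rewrite (_ : cube a r = [set x : 'rV[R]_n | forall i,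
  (fun i => `[a ord0 i - r, a ord0 i + r]%classic) i (x ord0 i)]).
  apply: (@rV_compact R n (fun i => `[a ord0 i - r, a ord0 i + r]%classic)) => i.
  exact: segment_compact.
by apply/seteqP; split => x xa i; have := xa i; rewrite /= in_itv/= ler_distl.
Qed.

Lemma compact_sub_cube n (K : set 'rV[R]_n) : compact K ->
  exists r, K `<=` cube 0 r.
Proof.
move=> /compact_bounded[M [_ KM]]; exists (M + 1) => x Kx i.
rewrite mxE subr0; apply: le_trans (KM (M + 1) _ x Kx); last by rewrite ltrDl.
rewrite [leRHS]/Num.norm/= mx_normrE; apply/bigmax_geP; right => /=.
by exists (ord0, i).
Qed.

(** Cubes are products along the decomposition that defines the measure, which
is what inductions on the dimension need. *)
Lemma cube_uncons n (a : 'rV[R]_n.+1) (r : R) : @cons_rV R n @^-1` cube a r =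
  [set t | `|t - a ord0 ord0| <= r] `*` cube (uncons_rV a).2 r.
Proof.
apply/seteqP; split => [[t x] /= tx|[t x] /= [tx xa] i].
  split => [|i].
    by have := tx ord0; rewrite mxE unlift_none.
  by have := tx (lift ord0 i); rewrite !mxE liftK.
case: (unliftP ord0 i) => [j|] ->; rewrite !mxE ?unlift_none// liftK/=.
by have := xa j; rewrite mxE.
Qed.

Lemma itv_distE (b r : R) : [set t : R | `|t - b| <= r] = `[b - r, b + r]%classic.
Proof. by apply/seteqP; split => t /=; rewrite in_itv/= ler_distl. Qed.

Lemma measurable_cube n (a : 'rV[R]_n) (r : R) : measurable (cube a r).
Proof.
rewrite (_ : cube a r =
  \big[setI/setT]_(i < n) (rV_coord i @^-1` [set t | `|t - a ord0 i| <= r])).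
  apply: bigsetI_measurable => i _; rewrite -[X in measurable X]setTI.
  by apply: measurable_rV_coord => //; rewrite itv_distE; exact: measurable_itv.
apply/seteqP; split => y ya.
  by rewrite -bigcap_seq => i _; exact: ya.
move=> i; move: ya; rewrite -bigcap_seq => /(_ i)/=; apply.
by rewrite /= mem_index_enum.
Qed.

Lemma lebesgue_rV_cons n (A : set 'rV[R]_n.+1) :
  lebesgue_rV n.+1 A = (lebesgue_measure \x lebesgue_rV n)%E (@cons_rV R n @^-1` A).
Proof. by []. Qed.

Lemma lebesgue_cube n (a : 'rV[R]_n) (r : R) : 0 <= r ->
  lebesgue_rV n (cube a r) = ((r *+ 2) ^+ n)%:E.
Proof.
move=> r0; elim: n a => [|n IH] a.
  rewrite expr0 (_ : lebesgue_rV 0 _ = \d_(0 : 'rV[R]_0) (cube a r))// diracE.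
  by rewrite mem_set// => -[].
rewrite lebesgue_rV_cons cube_uncons product_measure1E; last 2 first.
- by rewrite itv_distE; exact: measurable_itv.
- exact: measurable_cube.
have lebE : lebesgue_measure (`[a ord0 ord0 - r, a ord0 ord0 + r]%classic
    : set (measurableTypeR R)) = (r *+ 2)%:E.
  rewrite lebesgue_measure_itv/= lte_fin; case: ltP => ?.
    by rewrite -EFinB; congr EFin; rewrite mulr2n; ring.
  by congr EFin; rewrite mulr2n; lra.
rewrite IH exprS EFinM; congr (_ * _)%E.
by rewrite -lebE -itv_distE.
Qed.

End cubes.

(** * The integral of a partial derivative *)

Lemma integrable_bounded d (T : measurableType d) (R : realType)
    (mu : {measure set T -> \bar R}) (A : set T) (f : T -> R) (C : R) :
  measurable A -> (mu A < +oo)%E -> measurable_fun setT f ->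
  (forall x, `|f x| <= C) -> (forall x, ~ A x -> f x = 0) ->
  mu.-integrable setT (EFin \o f).
Proof.
move=> mA Aoo mf fC f0.
have -> : EFin \o f = (EFin \o f) \_ A.
  apply/funext => x; rewrite patchE; case: ifPn => // /negP.
  by rewrite inE => /f0/= ->.
apply/(integrable_mkcond _ mA)/measurable_bounded_integrable => //.
  exact: measurable_funTS.
exists C; split; first exact: num_real.
by move=> M CM x _; exact: le_trans (fC x) (ltW CM).
Qed.

Lemma Lfun2_bounded d (T : measurableType d) (R : realType)
    (mu : {measure set T -> \bar R}) (A : set T) (f : T -> R) (C : R) :
  measurable A -> (mu A < +oo)%E -> measurable_fun setT f ->
  (forall x, `|f x| <= C) -> (forall x, ~ A x -> f x = 0) ->
  f \in Lfun mu 2%:E.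
Proof.
move=> mA Aoo mf fC f0; rewrite inE; apply/andP; split; rewrite inE//=.
have /integrableP[_] : mu.-integrable setT (EFin \o (fun x => f x ^+ 2)).
  apply: (@integrable_bounded _ _ _ _ A _ (C ^+ 2)) => //.
  - exact: measurable_funX.
  - by move=> x; rewrite normrX lerXn2r// ?nnegrE// (le_trans _ (fC x)).
  - by move=> x /f0 ->; rewrite expr0n.
rewrite /finite_norm unlock => /(poweR_lty 2^-1); congr (_ `^ _ < _)%E.
apply: eq_integral => x _ /=; congr EFin.
by rewrite ger0_norm ?sqr_ge0// -real_normK ?num_real// powR_mulrn.
Qed.

Section cube_supported.
Context {R : realType}.

Lemma continuous_bounded_cube n (a : 'rV[R]_n) (r : R) (f : 'rV[R]_n -> R) :
  continuous f -> (forall x, ~ cube a r x -> f x = 0) ->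
  exists C, forall x, `|f x| <= C.
Proof.
move=> cf f0.
have /compact_bounded[M [_ fM]] : compact (f @` cube a r).
  by apply: continuous_compact; [exact: continuous_subspaceT|exact: cube_compact].
exists (`|M| + 1) => x; have [xa|/f0->] := pselect (cube a r x).
  by apply: (fM (`|M| + 1)) => //; rewrite ltr_pwDr// ler_norm.
by rewrite normr0 addr_ge0.
Qed.

Lemma lebesgue_cube_fin n (a : 'rV[R]_n) (r : R) :
  (lebesgue_rV n (cube a r) < +oo)%E.
Proof.
have [r0|r0] := leP 0 r; first by rewrite lebesgue_cube// ltry.
apply: (@le_lt_trans _ _ (lebesgue_rV n (cube a 0))); last first.
  by rewrite lebesgue_cube// ltry.
apply: le_measure; rewrite ?inE; try exact: measurable_cube.
by move=> x xa i; exact: le_trans (xa i) (ltW r0).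
Qed.

Lemma integrable_cube_supported n (a : 'rV[R]_n) (r : R) (f : 'rV[R]_n -> R) :
  continuous f -> (forall x, ~ cube a r x -> f x = 0) ->
  (lebesgue_rV n).-integrable setT (EFin \o f).
Proof.
move=> cf f0; have [C fC] := continuous_bounded_cube cf f0.
apply: (integrable_bounded (measurable_cube a r) _ _ fC) => //.
  exact: lebesgue_cube_fin.
exact: continuous_measurable_rV.
Qed.

Lemma Lfun2_cube_supported n (a : 'rV[R]_n) (r : R) (f : 'rV[R]_n -> R) :
  continuous f -> (forall x, ~ cube a r x -> f x = 0) ->
  f \in Lfun (lebesgue_rV n) 2%:E.
Proof.
move=> cf f0; have [C fC] := continuous_bounded_cube cf f0.
apply: (Lfun2_bounded (measurable_cube a r) _ _ fC) => //.
  exact: lebesgue_cube_fin.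
exact: continuous_measurable_rV.
Qed.

End cube_supported.

Section integral_of_a_partial_derivative.
Context {R : realType}.

(** A directional derivative only depends on the restriction to the line, so it
can be carried between spaces of different dimensions: to slices of a function,
and from one variable to one factor of a product. *)
Lemma is_derive_along (V W : normedModType R) (g : V -> R) (k : W -> R)
    (c v : V) (d w : W) (l : R) :
  (forall h, g (h *: v + c) = k (h *: w + d)) ->
  is_derive c v g l -> is_derive d w k l.
Proof.
move=> gk [dg dgl].
have gkE : (fun h : R => h^-1 *: ((k \o shift d) (h *: w) - k d)) =
           (fun h : R => h^-1 *: ((g \o shift c) (h *: v) - g c)).
  apply/funext => h /=; rewrite gk; congr (_ *: (_ - _)).
  by have := gk 0; rewrite !scale0r !add0r.
split; first by rewrite /derivable gkE.
by rewrite /derive gkE.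
Qed.

Lemma continuous_cons_l n (x : 'rV[R]_n) :
  continuous (fun t : R => cons_rV (t, x)).
Proof.
move=> t; apply/(@cvg_ballP _ _ _ (nbhs t)) => e e0; near=> s.
have ts : ball t e s by near: s; exact: nbhsx_ballx.
apply/ball_rVE => // i; rewrite !mxE; case: unliftP => [j|] _ /=.
  by rewrite subrr normr0.
exact: ts.
Unshelve. all: by end_near. Qed.

Lemma continuous_cons_r n (t : R) :
  continuous (fun x : 'rV[R]_n => cons_rV (t : measurableTypeR R, x)).
Proof.
move=> x; apply/(@cvg_ballP _ _ _ (nbhs x)) => e e0; near=> y.
have xy : ball x e y by near: y; exact: nbhsx_ballx.
apply/ball_rVE => // i; rewrite !mxE; case: unliftP => [j|] _ /=.
  by move/(ball_rVE _ _ e0) : xy; apply.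
by rewrite subrr normr0.
Unshelve. all: by end_near. Qed.

Lemma cons_rV_head n (t h : R) (x : 'rV[R]_n) :
  h *: delta_mx ord0 ord0 + cons_rV (t : measurableTypeR R, x) =
  cons_rV (h + t : measurableTypeR R, x).
Proof.
apply/rowP => i; rewrite !mxE; case: unliftP => [j|] ->/=.
  by rewrite mulr0 add0r.
by rewrite mulr1.
Qed.

Lemma cons_rV_tail n (t h : R) (j : 'I_n) (x : 'rV[R]_n) :
  h *: delta_mx ord0 (lift ord0 j) + cons_rV (t : measurableTypeR R, x) =
  cons_rV (t : measurableTypeR R, h *: delta_mx ord0 j + x).
Proof.
apply/rowP => i; rewrite !mxE; case: unliftP => [k|] ->/=.
  by rewrite !mxE (inj_eq lift_inj).
by rewrite mulr0 add0r.
Qed.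

Lemma integral_derive_eq0 (H h : R -> R) (b r : R) :
  continuous h -> (forall t : R, is_derive t 1 H (h t)) ->
  (forall t, r < `|t - b| -> H t = 0) -> (forall t, r < `|t - b| -> h t = 0) ->
  (\int[lebesgue_measure]_t (h t)%:E = 0)%E.
Proof.
move=> ch dH H0 h0.
(* H vanishes at b - M and b + M because M exceeds r strictly *)
pose M : R := `|r| + 1.
have M0 : 0 < M by rewrite ltr_pwDr.
have rM : r < M by rewrite ltr_pwDr// ler_norm.
have -> : (\int[lebesgue_measure]_t (h t)%:E =
  \int[lebesgue_measure]_(t in `[(b - M)%R, (b + M)%R]) (h t)%:E)%E.
  rewrite [RHS]integral_mkcond; apply: eq_integral => t _.
  rewrite patchE; case: ifPn => // /negP; rewrite inE/= in_itv/= -ler_distl.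
  by move/negP; rewrite -ltNge => Mt; rewrite h0// (lt_trans rM).
have cH : continuous H.
  by move=> t; apply/differentiable_continuous/derivable1_diffP; case: (dH t).
have H0' (s : R) : `|s| = M -> H (b + s) = 0.
  by move=> sM; apply: H0; rewrite addrC addKr sM.
have ab : b - M < b + M by rewrite ltrD2l gtrN.
rewrite (@continuous_FTC2 _ _ H _ _ ab); first last.
- by move=> t _; rewrite derive1E; case: (dH t).
- split; first by move=> t _; case: (dH t).
    by apply: cvg_at_right_filter; exact: cH.
  by apply: cvg_at_left_filter; exact: cH.
- exact: continuous_subspaceT.
by rewrite !H0' ?subee ?normrN ?gtr0_norm.
Qed.

(** Coordinate 0 is the one that [cons_rV] adds. In that direction the inner
integral over the line vanishes for each slice; in another direction the
integral over each hyperplane vanishes by induction. The bound [C], inherited by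
slices, makes the integrand integrable so that Fubini applies. *)
Lemma integral_partial_eq0 n (a : 'rV[R]_n) (r C : R) (i : 'I_n)
    (g dg : 'rV[R]_n -> R) :
  continuous dg -> (forall x, is_derive x (delta_mx ord0 i) g (dg x)) ->
  (forall x, `|dg x| <= C) ->
  (forall x, ~ cube a r x -> g x = 0) -> (forall x, ~ cube a r x -> dg x = 0) ->
  (\int[lebesgue_rV n]_x (dg x)%:E = 0)%E.
Proof.
elim: n a i g dg => [a []//|n IH] a i g dg cdg dgE dgC g0 dg0.
have mdg := continuous_measurable_rV cdg.
have idg : (@lebesgue_measure R \x lebesgue_rV n)%E.-integrable setT
    ((EFin \o dg) \o @cons_rV R n).
  rewrite compA.
  apply: (@integrable_bounded _ _ _ _ (@cons_rV R n @^-1` cube a r) _ C).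
  - rewrite -[X in measurable X]setTI; apply: measurable_cons_rV => //.
    exact: measurable_cube.
  - exact: (lebesgue_cube_fin a r).
  - by apply: measurableT_comp => //; exact: measurable_cons_rV.
  - by move=> x; exact: dgC.
  - by move=> x; exact: dg0.
have -> : (\int[lebesgue_rV n.+1]_x (dg x)%:E =
    \int[@lebesgue_measure R \x lebesgue_rV n]_z (dg (cons_rV z))%:E)%E.
  rewrite (@integral_pushforward _ _ _ _ _ _ (@measurable_cons_rV R n) _ setT
    (EFin \o dg))//.
  exact/measurable_EFinP.
case: (unliftP ord0 i) => [j|] iE; rewrite {i}iE in dgE *.
  rewrite -(integral12_prod_meas1 idg) integral0_eq// => t _.
  rewrite /fubini_F/=.
  apply: (IH (uncons_rV a).2 j (fun y => g (cons_rV (t, y)))).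
  - move=> y; apply: continuous_comp; last exact: cdg.
    exact: continuous_cons_r.
  - move=> y; apply: is_derive_along (dgE (cons_rV (t, y))) => h.
    by rewrite cons_rV_tail.
  - by move=> y; exact: dgC.
  - move=> y ya; apply: g0 => ta; apply: ya.
    by have : (@cons_rV R n @^-1` cube a r) (t, y) by []; rewrite cube_uncons => -[].
  - move=> y ya; apply: dg0 => ta; apply: ya.
    by have : (@cons_rV R n @^-1` cube a r) (t, y) by []; rewrite cube_uncons => -[].
rewrite -(integral21_prod_meas1 idg) integral0_eq// => y _.
rewrite /fubini_G/=.
have out t : r < `|t - a ord0 ord0| ->
    ~ cube a r (cons_rV (t : measurableTypeR R, y)).
  move=> rt ta; have : (@cons_rV R n @^-1` cube a r) (t, y) by [].
  by rewrite cube_uncons => -[/=]; rewrite leNgt rt.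
apply: (@integral_derive_eq0 (fun t => g (cons_rV (t, y))) _ (a ord0 ord0) r).
- move=> t; apply: continuous_comp; last exact: cdg.
  exact: continuous_cons_l.
- move=> t; apply: is_derive_along (dgE (cons_rV (t, y))) => h.
  by rewrite cons_rV_head [h *: 1]mulr1.
- by move=> t /out; exact: g0.
- by move=> t /out; exact: dg0.
Qed.

End integral_of_a_partial_derivative.

(** * Smooth bumps *)

Section smooth.
Context {R : realType}.

(** C^k on the line with the derivative as an existential witness: closure
under products and affine changes of variable then needs no computation of
[f^`()]. *)
Fixpoint smooth k (f : R -> R) : Prop :=
  if k is k'.+1 then
    exists2 df, (forall t : R, is_derive t 1 f (df t)) & smooth k' df
  else continuous f.

Lemma is_derive_continuous (f df : R -> R) :
  (forall t : R, is_derive t 1 f (df t)) -> continuous f.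
Proof.
by move=> d t; apply/differentiable_continuous/derivable1_diffP; case: (d t).
Qed.

Lemma smoothW k f : smooth k.+1 f -> smooth k f.
Proof.
elim: k f => [|k IH] f [df fdf sdf]; first exact: is_derive_continuous fdf.
by exists df => //; exact: IH.
Qed.

Lemma smooth_continuous k f : smooth k f -> continuous f.
Proof. by case: k => // k [df /is_derive_continuous]. Qed.

Lemma smooth_cst k (c : R) : smooth k (cst c).
Proof.
elim: k c => [|k IH] c; first by move=> t; exact: cst_continuous.
by exists (cst 0) => // t; exact: is_derive_cst.
Qed.

Lemma smoothD k f g : smooth k f -> smooth k g -> smooth k (f \+ g).
Proof.
elim: k f g => [|k IH] f g.
  by move=> cf cg t; exact: continuousD (cf t) (cg t).
move=> [df fdf sdf] [dg gdg sdg]; exists (df \+ dg); last exact: IH.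
by move=> t; exact: is_deriveD.
Qed.

Lemma smoothM k f g : smooth k f -> smooth k g -> smooth k (f \* g).
Proof.
elim: k f g => [|k IH] f g.
  by move=> cf cg t; exact: continuousM (cf t) (cg t).
move=> sf sg; have [df fdf sdf] := sf; have [dg gdg sdg] := sg.
exists (f \* dg \+ g \* df); first by move=> t; exact: is_deriveM.
by apply: smoothD; apply: IH => //; exact: smoothW.
Qed.

Lemma smooth_affine k f (c d : R) : smooth k f ->
  smooth k (fun t => f (c * t + d)).
Proof.
elim: k f => [|k IH] f.
  move=> cf t; apply: continuous_comp; last exact: cf.
  apply: continuousD; last exact: cst_continuous.
  by apply: continuousM; [exact: cst_continuous|].
move=> [df fdf sdf]; exists (fun t => c * df (c * t + d)).
  move=> t; have : is_derive t 1 (fun t : R => c * t + d) c.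
    have := is_deriveD (is_deriveZ c (is_derive_id t (1 : R))) (is_derive_cst d t 1).
    by rewrite addr0 [c *: 1]mulr1.
  move=> dct; rewrite mulrC.
  exact: (@is_derive1_comp _ f (fun t => c * t + d)).
by apply: smoothM; [exact: smooth_cst|exact: IH].
Qed.

(** This family, for all m, is closed under differentiation up to linear
combinations, so the smoothness of exp(-1/t) needs no general formula for its
higher derivatives. *)
Definition flat m (t : R) : R :=
  if 0 < t then t^-1 ^+ m * expR (- t^-1) else 0.

(** From s^(m+1) / (m+1)! <= e^s at s = 1/t. It yields the derivative 0 at the
origin, since [flat m t / t = flat m.+1 t]. *)
Lemma flat_bound m (t : R) : `|flat m t| <= m.+1`!%:R * `|t|.
Proof.
rewrite /flat; case: ifPn => t0; last by rewrite normr0 mulr_ge0.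
have s0 : 0 < t^-1 by rewrite invr_gt0.
rewrite ger0_norm; last by rewrite mulr_ge0 ?expR_ge0 ?exprn_ge0 ?ltW.
rewrite (gtr0_norm t0) expRN ler_pdivrMr ?expR_gt0//.
have := expR_ge1Dxn m (ltW s0) => h.
have : t^-1 ^+ m.+1 / m.+1`!%:R <= expR t^-1 by apply: le_trans h; rewrite lerDr.
rewrite ler_pdivrMr ?ltr0n ?fact_gt0// => h2.
rewrite -(ler_pM2l s0) -exprS (le_trans h2)// le_eqVlt; apply/orP; left; apply/eqP.
by field; rewrite gt_eqF.
Qed.

Lemma is_derive_flat m (t : R) :
  is_derive t 1 (flat m) (flat m.+2 t - m%:R * flat m.+1 t).
Proof.
have [t0|t0|<-] := ltgtP 0 t.
(* for t > 0, flat m is phi composed with the inverse near t *)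
- pose phi (s : R) : R := s ^+ m * expR (- s).
  have dphi (s : R) : is_derive s 1 phi (m%:R * s ^+ m.-1 * expR (- s) - phi s).
    have dE : is_derive s 1 (fun s : R => expR (- s)) (- expR (- s)).
      have := is_derive1_comp (is_derive_expR (- s)) (is_deriveNid s (1 : R)).
      by rewrite mulrN1.
    have phiE : phi = (id ^+ m) * (fun s : R => expR (- s)).
      by apply/funext => u; rewrite /phi [RHS]/GRing.mul/= exprfctE.
    rewrite {1}phiE.
    apply: is_derive_eq (is_deriveM (is_deriveX m (is_derive_id s (1 : R))) dE) _.
    by rewrite /phi /GRing.scale/= exprfctE; ring.
  apply: (@near_eq_is_derive _ _ _ (fun u : R => phi u^-1)).
    near=> u; have u0 : 0 < u by near: u; exact: lt_nbhsr.
    by rewrite /flat u0.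
  have dV : is_derive t 1 (fun u : R => u^-1) (- t ^- 2).
    have t0' : id t != 0 by rewrite gt_eqF.
    apply: is_derive_eq (is_deriveV t0' (is_derive_id t (1 : R))) _.
    by rewrite [_ *: 1]mulr1.
  apply: is_derive_eq (is_derive1_comp (dphi t^-1) dV) _.
  rewrite /flat t0 /phi -exprVn; set s := t^-1; case: (m) => [|m'] /=.
    by rewrite !mul0r; ring.
  by rewrite !exprS; ring.
- have -> : flat m.+2 t - m%:R * flat m.+1 t = 0.
    by rewrite /flat ltNge (ltW t0)/= mulr0 subr0.
  apply: near_eq_is_derive (is_derive_cst (0 : R) t (1 : R)).
  near=> u; have u0 : u < 0 by near: u; exact: lt_nbhsl.
  by rewrite /flat ltNge (ltW u0).
- have -> : flat m.+2 0 - m%:R * flat m.+1 0 = 0.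
    by rewrite /flat ltxx mulr0 subr0.
  have norm0 : `|h| @[h --> (0 : R)^'] --> (0 : R).
    have : `|h| @[h --> (0 : R)^'] --> `|0 : R|.
      by apply: cvg_norm; exact: cvg_within.
    by rewrite normr0.
  have bound0 : m.+2`!%:R * `|h| @[h --> (0 : R)^'] --> (0 : R).
    rewrite -[X in _ --> X](mulr0 (m.+2`!%:R : R)).
    by apply: cvgM norm0; exact: cvg_cst.
  have lim0 : (fun h : R => h^-1 *: ((flat m \o shift 0) (h *: 1) - flat m 0))
      @ 0^' --> (0 : R).
    apply: (@squeeze_cvgr _ _ _ _ (fun h : R => - (m.+2`!%:R * `|h|))
      (fun h => m.+2`!%:R * `|h|)).
    + near=> h; rewrite -ler_norml.
      have -> : h^-1 *: ((flat m \o shift 0) (h *: 1) - flat m 0) = flat m.+1 h.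
        rewrite /flat/= ltxx subr0 addr0 [h *: 1]mulr1 /GRing.scale/=.
        by case: ifPn => _; rewrite ?mulr0// exprS mulrA.
      exact: flat_bound.
    + rewrite -[X in _ --> X]oppr0; exact: cvgN bound0.
    + exact: bound0.
  split; first by apply/cvg_ex; exists 0.
  exact: cvg_lim lim0.
Unshelve. all: by end_near. Qed.

Lemma smooth_flat k m : smooth k (flat m).
Proof.
elim: k m => [|k IH] m.
  by apply: is_derive_continuous => t; exact: is_derive_flat.
exists (fun t => flat m.+2 t - m%:R * flat m.+1 t).
  by move=> t; exact: is_derive_flat.
rewrite (_ : (fun t => _) = flat m.+2 \+ (cst (- m%:R) \* flat m.+1)).
  by apply: smoothD => //; apply: smoothM => //; exact: smooth_cst.
by apply/funext => t /=; rewrite mulNr.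
Qed.

Definition bump (b r : R) (t : R) : R :=
  flat 0 (r + (t - b)) * flat 0 (r - (t - b)).

Lemma smooth_bump k b r : smooth k (bump b r).
Proof.
have -> : bump b r =
    (fun t => flat 0 (1 * t + (r - b))) \* (fun t => flat 0 (-1 * t + (r + b))).
  by apply/funext => t; rewrite /bump/=; congr (flat 0 _ * flat 0 _); ring.
by apply: smoothM; apply: smooth_affine; exact: smooth_flat.
Qed.

Lemma flat_gt0 m (t : R) : 0 < t -> 0 < flat m t.
Proof. by move=> t0; rewrite /flat t0 mulr_gt0 ?expR_gt0 ?exprn_gt0 ?invr_gt0. Qed.

Lemma bump_gt0 b r t : `|t - b| < r -> 0 < bump b r t.
Proof.
rewrite ltr_norml => /andP[h1 h2]; apply: mulr_gt0; apply: flat_gt0; lra.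
Qed.

Lemma bump_eq0 b r t : r <= `|t - b| -> bump b r t = 0.
Proof.
rewrite ler_normr /bump /flat => /orP[h|h].
  by rewrite [X in _ * X]ifF ?mulr0//; apply/negbTE; rewrite -leNgt; lra.
by rewrite [X in X * _]ifF ?mul0r//; apply/negbTE; rewrite -leNgt; lra.
Qed.

End smooth.

Section product.
Context {R : realType}.

Lemma continuous_prod_coord n (c : 'I_n -> R -> R) (P : pred 'I_n) :
  (forall j, continuous (c j)) ->
  continuous (fun x : 'rV[R]_n => \prod_(j < n | P j) c j (x ord0 j)).
Proof.
move=> cc; rewrite unlock /=; elim: (index_enum _) => [|j s IH] /=.
  by move=> x; exact: cst_continuous.
case: (P j) => // x.
apply: (@continuousM _ _ (fun x : 'rV[R]_n => c j (x ord0 j))); last exact: IH.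
by apply: continuous_comp; [exact: coord_continuous|exact: cc].
Qed.

(** Only factor i varies along the i-th axis; the derivative keeps the shape of a
product over coordinates, which is what lets [Ck_prod_coord] iterate. *)
Lemma is_derive_prod_coord n (c : 'I_n -> R -> R) (i : 'I_n) (dc : R -> R) :
  (forall t : R, is_derive t 1 (c i) (dc t)) -> forall x : 'rV[R]_n,
  is_derive x (delta_mx ord0 i) (fun x : 'rV[R]_n => \prod_j c j (x ord0 j))
    (\prod_j (if j == i then dc else c j) (x ord0 j)).
Proof.
move=> dci x; pose K := \prod_(j < n | j != i) c j (x ord0 j).
have -> : \prod_j (if j == i then dc else c j) (x ord0 j) = K *: dc (x ord0 i).
  rewrite (bigD1 i)//= eqxx [LHS]mulrC; congr (_ * _).
  by apply: eq_bigr => j /negbTE ->.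
have dK : is_derive (x ord0 i) 1 (K \*: c i) (K *: dc (x ord0 i)).
  exact: is_deriveZ.
apply: is_derive_along dK => h /=.
rewrite [RHS](bigD1 i)//= !mxE !eqxx/= [RHS]mulrC; congr (_ * _).
by apply: eq_bigr => j /negbTE ji; rewrite !mxE ji andbF mulr0 add0r.
Qed.

Lemma Ck_prod_coord k n (c : 'I_n -> R -> R) : (forall j, smooth k (c j)) ->
  Ck k (fun x : 'rV[R]_n => \prod_j c j (x ord0 j)).
Proof.
elim: k c => [|k IH] c sc; (split; first by
  apply: continuous_prod_coord => j; exact: smooth_continuous (sc j)) => //.
move=> i; have [dc cdc sdc] := sc i.
have d := is_derive_prod_coord cdc.
split; first by move=> x; case: (d x).
have -> : partial i (fun x : 'rV[R]_n => \prod_j c j (x ord0 j)) =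
    fun x : 'rV[R]_n => \prod_j (if j == i then dc else c j) (x ord0 j).
  by apply/funext => x; rewrite /partial; case: (d x).
apply: (IH (fun j => if j == i then dc else c j)) => j.
by case: ifPn => // _; exact: smoothW.
Qed.

End product.

(** * Test functions as elements of H^1_0, and scaling *)

Section Lq_norm.
Context {R : realType} {N : nat}.
Implicit Types (Omega : set 'rV[R]_N) (f : 'rV[R]_N -> R).

Lemma restrictZ Omega (c : R) f :
  (fun x => c * f x) \_ Omega = (fun x => c * (f \_ Omega) x).
Proof. by apply/funext => x; rewrite !patchE; case: ifP; rewrite ?mulr0. Qed.

Lemma restrict_id Omega f : (forall x, ~ Omega x -> f x = 0) -> f \_ Omega = f.
Proof.
move=> f0; apply/funext => x; rewrite patchE; case: ifPn => // /negP.
by rewrite inE => /f0 ->.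
Qed.

Lemma Lq_norm_ge0 Omega q f : 0 <= Lq_norm Omega q f.
Proof. by rewrite fine_ge0// Lnorm_ge0. Qed.

(** Also true when the norm of [f] is infinite, as both sides are then 0. *)
Lemma Lq_normZ Omega q (c : R) f : 0 <= c -> 0 < q ->
  measurable_fun setT (f \_ Omega) ->
  Lq_norm Omega q (fun x => c * f x) = c * Lq_norm Omega q f.
Proof.
move=> c0 q0 mf; rewrite /Lq_norm restrictZ.
have -> : ('N[lebesgue_rV N]_q%:E[EFin \o (fun x => (c * (f \_ Omega) x)%R)] =
    c%:E * 'N[lebesgue_rV N]_q%:E[EFin \o f \_ Omega])%E.
  rewrite unlock /Lnorm.
  under eq_integral => x _ do rewrite /= normrM (ger0_norm c0) powRM// EFinM.
  rewrite ge0_integralZl_EFin//; last exact: powR_ge0.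
    rewrite poweRM ?lee_fin ?powR_ge0//; last by apply: integral_ge0.
    by rewrite poweR_EFin -powRrM mulfV ?gt_eqF// powRr1.
  apply/measurable_EFinP; apply: (measurableT_comp (measurable_powR _)).
  exact: measurableT_comp.
have := Lnorm_ge0 (lebesgue_rV N) q%:E (EFin \o f \_ Omega).
case: ('N[_]_ _ [_])%E => [s|_|//]; first by rewrite -EFinM.
have [->|cn0] := eqVneq c 0; first by rewrite mul0e mul0r.
by rewrite gt0_muley ?lte_fin ?lt_def ?cn0//= mulr0.
Qed.

Lemma in_L2_measurable Omega f : in_L2 Omega f -> measurable_fun setT (f \_ Omega).
Proof. by rewrite /in_L2 inE => /andP[+ _]; rewrite inE. Qed.

Lemma in_L2Z Omega (c : R) f : in_L2 Omega f -> in_L2 Omega (fun x => c * f x).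
Proof.
move=> L2f; rewrite /in_L2 restrictZ.
rewrite (_ : (fun x => _) = c \o* (f \_ Omega)).
  by apply: Lfun_scale => //; rewrite ler1n.
by apply/funext => x; rewrite /= mulrC.
Qed.

Lemma Lq_norm_ae0 Omega q f : 0 < q -> measurable_fun setT (f \_ Omega) ->
  f = cst 0 %[ae lebesgue_rV N in Omega] -> Lq_norm Omega q f = 0.
Proof.
move=> q0 mf f0; rewrite /Lq_norm unlock /Lnorm.
rewrite (@ae_eq_integral _ _ _ _ _ (cst 0%E))//.
- by rewrite integral0 poweR0r// invr_neq0// gt_eqF.
- apply/measurable_EFinP; apply: (measurableT_comp (measurable_powR _)).
  exact: measurableT_comp.
- apply: filterS f0 => x /= f0 _; rewrite patchE; case: ifPn.
    by rewrite inE => /f0 ->; rewrite normr0 powR0// gt_eqF.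
  by move=> _; rewrite normr0 powR0// gt_eqF.
Qed.

Lemma L2_norm_eq0 Omega f : in_L2 Omega f -> Lq_norm Omega 2 f = 0 ->
  f = cst 0 %[ae lebesgue_rV N in Omega].
Proof.
move=> L2f; have mf := in_L2_measurable L2f.
move: L2f; rewrite /in_L2 inE => /andP[_].
rewrite inE/= /finite_norm /Lq_norm => fin.
move/eqP; rewrite fine_eq0; last by rewrite ge0_fin_numE// Lnorm_ge0.
move/eqP => N0.
have : EFin \o f \_ Omega = \0%E %[ae lebesgue_rV N].
  by apply: Lnorm_eq0_eq0 N0 => //; exact/measurable_EFinP.
apply: filterS => x /= /(_ I) + xO; by rewrite patchE mem_set// => -[->].
Qed.

End Lq_norm.

Section test_functions.
Context {R : realType} {N : nat}.
Implicit Types (Omega : set 'rV[R]_N) (f phi u : 'rV[R]_N -> R) (i : 'I_N).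

Lemma eq0_out_support f x : ~ Defs.support f x -> f x = 0.
Proof.
by apply: contra_notP => /eqP fx; exact: (@subset_closure _ [set y | f y != 0] x fx).
Qed.

Lemma partial_eq0_out_support f i x : ~ Defs.support f x -> partial i f x = 0.
Proof.
move=> fx; rewrite /partial.
have U : nbhs x (~` Defs.support f).
  by apply: open_nbhs_nbhs; split => //; rewrite openC; exact: closed_closure.
have : is_derive x (delta_mx ord0 i) f 0.
  apply: near_eq_is_derive (is_derive_cst (0 : R) x (delta_mx ord0 i)).
  by near=> y; rewrite [RHS]eq0_out_support//; near: y; exact: U.
by case.
Unshelve. all: by end_near. Qed.

Section one_test_function.
Context (Omega : set 'rV[R]_N) (phi : 'rV[R]_N -> R).
Context (tphi : test_function Omega phi).

Lemma test_function_continuous : continuous phi.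
Proof. by case: tphi => /(_ 0%N)[]. Qed.

Lemma is_derive_test_function i x :
  is_derive x (delta_mx ord0 i) phi (partial i phi x).
Proof. by case: tphi => /(_ 1%N)[_ /(_ i)[d _]] _ _; split. Qed.

Lemma test_function_partial_continuous i : continuous (partial i phi).
Proof. by case: tphi => /(_ 1%N)[_ /(_ i)[_ []]]. Qed.

Lemma test_function_out x : ~ Omega x -> phi x = 0.
Proof. by case: tphi => _ _ sO Ox; apply: eq0_out_support => /sO. Qed.

Lemma test_function_partial_out i x : ~ Omega x -> partial i phi x = 0.
Proof. by case: tphi => _ _ sO Ox; apply: partial_eq0_out_support => /sO. Qed.

Lemma test_function_sub_cube : exists r, Defs.support phi `<=` cube 0 r.
Proof. by case: tphi => _ /compact_sub_cube. Qed.

Lemma test_function_in_L2 : in_L2 Omega phi.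
Proof.
have [r sr] := test_function_sub_cube.
rewrite /in_L2 restrict_id; last exact: test_function_out.
apply: (@Lfun2_cube_supported _ _ 0 r); first exact: test_function_continuous.
by move=> x xr; apply: eq0_out_support => /sr.
Qed.

Lemma test_function_partial_in_L2 i : in_L2 Omega (partial i phi).
Proof.
have [r sr] := test_function_sub_cube.
rewrite /in_L2 restrict_id; last exact: test_function_partial_out.
apply: (@Lfun2_cube_supported _ _ 0 r); first exact: test_function_partial_continuous.
by move=> x xr; apply: partial_eq0_out_support => /sr.
Qed.

End one_test_function.

(** The sum of the two integrands is the partial derivative of [u * phi]. *)
Lemma test_integration_by_parts Omega u phi i :
  test_function Omega u -> test_function Omega phi ->
  \int[lebesgue_rV N]_(x in Omega) (u x * partial i phi x) =
  - \int[lebesgue_rV N]_(x in Omega) (partial i u x * phi x).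
Proof.
move=> tu tphi; have [r ur] := test_function_sub_cube tu.
have u0 x : ~ cube 0 r x -> u x = 0 by move=> xr; apply: eq0_out_support => /ur.
have du0 x : ~ cube 0 r x -> partial i u x = 0.
  by move=> xr; apply: partial_eq0_out_support => /ur.
pose f := u \* partial i phi; pose g := partial i u \* phi.
have cf : continuous f.
  by move=> x; apply: continuousM; [exact: (test_function_continuous tu)|
    exact: (test_function_partial_continuous tphi)].
have cg : continuous g.
  by move=> x; apply: continuousM; [exact: (test_function_partial_continuous tu)|
    exact: (test_function_continuous tphi)].
have f0 x : ~ cube 0 r x -> f x = 0 by move=> /u0 ux; rewrite /f/= ux mul0r.
have g0 x : ~ cube 0 r x -> g x = 0 by move=> /du0 ux; rewrite /g/= ux mul0r.
have iF := integrable_cube_supported cf f0.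
have iG := integrable_cube_supported cg g0.
have cfg : continuous (f \+ g) by move=> x; exact: continuousD (cf x) (cg x).
have fg0 x : ~ cube 0 r x -> (f \+ g) x = 0.
  by move=> xr; rewrite /= f0// g0// addr0.
have [C fgC] := continuous_bounded_cube cfg fg0.
have fgE : (\int[lebesgue_rV N]_x ((f \+ g) x)%:E = 0)%E.
  apply: (integral_partial_eq0 cfg _ fgC _ fg0 (i := i) (g := u \* phi)).
    move=> x; have := is_deriveM (is_derive_test_function tu i x)
      (is_derive_test_function tphi i x).
    by rewrite [phi x *: _]mulrC.
  by move=> x xr; rewrite /= u0// mul0r.
have {}fgE : \int[lebesgue_rV N]_x f x + \int[lebesgue_rV N]_x g x = 0.
  by rewrite -RintegralD//= /Rintegral fgE.
rewrite Rintegral_mkcond [in RHS]Rintegral_mkcond.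
rewrite (@restrict_id _ _ _ (fun x => u x * partial i phi x)); last first.
  by move=> x /(test_function_out tu) ->; rewrite mul0r.
rewrite (@restrict_id _ _ _ (fun x => partial i u x * phi x)); last first.
  by move=> x /(test_function_out tphi) ->; rewrite mulr0.
by apply/eqP; rewrite -addr_eq0; exact/eqP.
Qed.

(** The classical partial derivatives serve as the weak gradient. *)
Definition H1_of_test_function Omega u (tu : test_function Omega u) : H1 Omega :=
  MkH1 (test_function_in_L2 tu) (test_function_partial_in_L2 tu)
    (fun i phi => @test_integration_by_parts Omega u phi i tu).

Lemma Lq_norm0 Omega (q : R) : 0 < q -> Lq_norm Omega q (fun=> 0) = 0.
Proof.
move=> q0; rewrite /Lq_norm restrict_id// [X in fine X](_ : _ = 0%E)//.
by apply: Lnorm0; rewrite eqe gt_eqF.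
Qed.

Lemma H10_test_function Omega u (tu : test_function Omega u) :
  H10 (H1_of_test_function tu).
Proof.
exists (fun=> u); split => // [|i] /=.
  rewrite (_ : u \- u = fun=> 0); last by apply/funext => x; rewrite /= subrr.
  by rewrite Lq_norm0//; exact: cvg_cst.
rewrite (_ : _ \- _ = fun=> 0); last by apply/funext => x; rewrite /= subrr.
by rewrite Lq_norm0//; exact: cvg_cst.
Qed.

Lemma CkZ k (c : R) f : Ck k f -> Ck k (fun x => c * f x).
Proof.
elim: k f => [|k IH] f [cf df].
  by split => // x; apply: continuousM; [exact: cst_continuous|exact: cf].
split; first by move=> x; apply: continuousM; [exact: cst_continuous|exact: cf].
move=> i; have [dfi cki] := df i.
have d x : is_derive x (delta_mx ord0 i) (fun x => c * f x) (c * partial i f x).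
  exact: (is_deriveZ c (derivableP (dfi x))).
split; first by move=> x; case: (d x).
rewrite (_ : partial i _ = fun x => c * partial i f x); first exact: IH.
by apply/funext => x; case: (d x).
Qed.

Lemma partialZ Omega (c : R) phi i : test_function Omega phi ->
  partial i (fun x => c * phi x) = fun x => c * partial i phi x.
Proof.
case=> /(_ 1%N)[_ /(_ i)[d _]] _ _.
by apply/funext => x; case: (is_deriveZ c (derivableP (d x))).
Qed.

Lemma test_functionZ Omega (c : R) phi : test_function Omega phi ->
  test_function Omega (fun x => c * phi x).
Proof.
case=> ck cpt sO.
have sub : Defs.support (fun x => c * phi x) `<=` Defs.support phi.
  by apply: closure_subset => x /=; apply: contra => /eqP ->; rewrite mulr0.
split; first by move=> k; exact: CkZ.
  by apply: subclosed_compact cpt sub; exact: closed_closure.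
exact: subset_trans sub sO.
Qed.

End test_functions.

Section scaling.
Context {R : realType} {N : nat} {Omega : set 'rV[R]_N}.
Implicit Types (u : H1 Omega) (c : R).

Lemma scale_H1_gradP u c i phi : test_function Omega phi ->
  \int[lebesgue_rV N]_(x in Omega) ((c * u x) * partial i phi x) =
  - \int[lebesgue_rV N]_(x in Omega) ((c * H1_grad u i x) * phi x).
Proof.
move=> tphi; have L1 (f g : 'rV[R]_N -> R) : in_L2 Omega f -> in_L2 Omega g ->
    \int[lebesgue_rV N]_(x in Omega) ((c * f x) * g x) =
    c * \int[lebesgue_rV N]_(x in Omega) (f x * g x).
  move=> Lf Lg; rewrite Rintegral_mkcond [in RHS]Rintegral_mkcond.
  have -> : (fun x => f x * g x) \_ Omega = f \_ Omega \* g \_ Omega.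
    by apply/funext => x; rewrite /= !patchE; case: ifP; rewrite ?mulr0.
  have -> : (fun x => (c * f x) * g x) \_ Omega =
      fun x => c * (f \_ Omega \* g \_ Omega) x.
    by apply/funext => x; rewrite /= !patchE; case: ifP; rewrite ?mulr0// mulrA.
  by rewrite RintegralZl//; exact/Lfun1_integrable/Lfun2_mul_Lfun1.
rewrite !L1//; first by rewrite H1_gradP// mulrN.
- exact: H1_grad_L2.
- exact: test_function_in_L2.
- exact: H1_fun_L2.
- exact: test_function_partial_in_L2.
Qed.

Definition scale_H1 c u : H1 Omega :=
  MkH1 (in_L2Z c (H1_fun_L2 u)) (fun i => in_L2Z c (H1_grad_L2 u i))
    (@scale_H1_gradP u c).

(** The approximating test functions are scaled along with [u]. *)
Lemma scale_H10 c u : 0 <= c -> H10 u -> H10 (scale_H1 c u).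
Proof.
move=> c0 [phi [tphi phiu dphiu]].
have scale_cvg (f : nat -> 'rV[R]_N -> R) (g : 'rV[R]_N -> R) :
    (forall k, in_L2 Omega (f k)) -> in_L2 Omega g ->
    Lq_norm Omega 2 (f k \- g) @[k --> \oo] --> (0 : R) ->
    Lq_norm Omega 2 ((fun x => c * f k x) \- (fun x => c * g x))
      @[k --> \oo] --> (0 : R).
  move=> Lf Lg fg0.
  rewrite (_ : (fun k => _) = fun k => c * Lq_norm Omega 2 (f k \- g)).
    rewrite -[X in _ --> X](mulr0 c).
    by apply: cvgM fg0; exact: cvg_cst.
  apply/funext => k; rewrite -Lq_normZ//.
    by congr (Lq_norm _ _ _); apply/funext => x /=; rewrite mulrBr.
  rewrite (_ : _ \_ _ = f k \_ Omega \- g \_ Omega).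
    by apply: measurable_funB; exact: in_L2_measurable.
  by apply/funext => x; rewrite /= !patchE; case: ifP; rewrite ?subr0.
exists (fun k x => c * phi k x); split.
- by move=> k; exact: test_functionZ.
- apply: scale_cvg phiu; last exact: H1_fun_L2.
  by move=> k; exact: test_function_in_L2.
- move=> i; rewrite (_ : (fun k => _) = fun k => Lq_norm Omega 2
    ((fun x => c * partial i (phi k) x) \- (fun x => c * H1_grad u i x))).
    apply: scale_cvg (dphiu i); last exact: H1_grad_L2.
    by move=> k; exact: test_function_partial_in_L2.
  by apply/funext => k; rewrite (partialZ _ _ (tphi k)).
Qed.

Lemma grad_norm_scale c u : 0 <= c -> grad_norm (scale_H1 c u) = c * grad_norm u.
Proof.
move=> c0; rewrite /grad_norm -Lq_normZ//.
  congr (Lq_norm _ _ _); apply/funext => x /=.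
  under eq_bigr do rewrite exprMn.
  by rewrite -mulr_sumr sqrtrM ?sqr_ge0// sqrtr_sqr ger0_norm.
pose G (x : 'rV[R]_N) : R := \sum_i (H1_grad u i \_ Omega) x ^+ 2.
rewrite (_ : _ \_ _ = @Num.sqrt R \o G).
  apply: measurableT_comp.
    by apply: continuous_measurable_fun; exact: sqrt_continuous.
  apply: measurable_sum => i; apply: measurable_funX.
  by apply: in_L2_measurable; exact: H1_grad_L2.
apply/funext => x; rewrite /= /G !patchE; case: ifPn => xO.
  by congr Num.sqrt; apply: eq_bigr => i _; rewrite patchE xO.
rewrite big1 ?sqrtr0// => i _.
by rewrite patchE (negbTE xO) expr0n.
Qed.

Lemma Lq_norm_scale c u q : 0 <= c -> 0 < q ->
  Lq_norm Omega q (scale_H1 c u) = c * Lq_norm Omega q u.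
Proof.
move=> c0 q0; apply: Lq_normZ => //.
by apply: in_L2_measurable; exact: H1_fun_L2.
Qed.

End scaling.

(** * A nonzero element of H^1_0 *)

Section bump_in_Omega.
Context {R : realType} {N : nat}.
Implicit Types (Omega : set 'rV[R]_N) (a : 'rV[R]_N).

Definition bump_rV a (r : R) (x : 'rV[R]_N) : R :=
  \prod_j bump (a ord0 j) r (x ord0 j).

Lemma bump_rV_gt0 a (r : R) (x : 'rV[R]_N) :
  (forall j, `|x ord0 j - a ord0 j| < r) ->
  0 < bump_rV a r x.
Proof. by move=> xa; apply: prodr_gt0 => j _; exact: bump_gt0. Qed.

Lemma support_bump_rV a (r : R) : Defs.support (bump_rV a r) `<=` cube a r.
Proof.
have cl : closed (cube a r).
  by apply: compact_closed; [exact: norm_hausdorff|exact: cube_compact].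
rewrite /Defs.support closureE; apply: smallest_sub => //.
move=> x /= + j; apply: contra_neqT; rewrite -ltNge => xj.
by apply/eqP/prodf_eq0; exists j => //; rewrite bump_eq0// ltW.
Qed.

Lemma test_function_bump_rV Omega a (r : R) : cube a r `<=` Omega ->
  test_function Omega (bump_rV a r).
Proof.
move=> aO; split.
- move=> k; apply: (@Ck_prod_coord _ k _ (fun j => bump (a ord0 j) r)) => j.
  exact: smooth_bump.
- have cpt : compact (cube a r) by exact: cube_compact.
  have sub := @support_bump_rV a r.
  by apply: subclosed_compact cpt sub; exact: closed_closure.
- by apply: subset_trans aO; exact: support_bump_rV.
Qed.

(** The concentric half cube has positive measure, and the bump is positive on
it. *)
Lemma bump_rV_neq0 Omega a (r : R) : 0 < r -> cube a r `<=` Omega ->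
  ~ (bump_rV a r = cst 0 %[ae lebesgue_rV N in Omega]).
Proof.
move=> r0 aO [A [mA A0 sub]].
have aA : cube a (r / 2) `<=` A.
  move=> x xa; apply: sub => /= bx0.
  have : 0 < bump_rV a r x.
    apply: bump_rV_gt0 => j; rewrite (le_lt_trans (xa j))//.
    by rewrite ltr_pdivrMr// ltr_pMr// ltr1n.
  rewrite bx0 ?ltxx//; apply: aO => j; apply: le_trans (xa j) _.
  by rewrite ler_pdivrMr// ler_pMr// ler1n.
have : (lebesgue_rV N (cube a (r / 2)) <= lebesgue_rV N A)%E.
  by apply: le_measure; rewrite ?inE//; exact: measurable_cube.
rewrite A0 lebesgue_cube; last by rewrite divr_ge0// ltW.
by rewrite lee_fin leNgt exprn_gt0// mulrn_wgt0// divr_gt0.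
Qed.

Lemma exists_H10_neq0 Omega : open Omega -> Omega !=set0 ->
  exists u : H1 Omega, H10 u /\ Lq_norm Omega 2 u != 0.
Proof.
move=> oO [a Oa].
have /nbhs_ballP[e /= e0 eO] : nbhs a Omega by exact: open_nbhs_nbhs.
have r0 : 0 < e / 2 by rewrite divr_gt0.
have aO : cube a (e / 2) `<=` Omega.
  move=> x xa; apply: eO; apply/ball_rVE => // i; rewrite distrC.
  by rewrite (le_lt_trans (xa i))// ltr_pdivrMr// ltr_pMr// ltr1n.
exists (H1_of_test_function (test_function_bump_rV aO)); split.
  exact: H10_test_function.
apply/eqP => /L2_norm_eq0 H; apply: (bump_rV_neq0 r0 aO); apply: H.
exact: (H1_fun_L2 (H1_of_test_function (test_function_bump_rV aO))).
Qed.

End bump_in_Omega.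

(** * Duality along rays *)

Section duality.
Context {R : realType} {N : nat} {Omega : set 'rV[R]_N} {p : R}.
Context (hp : 2 < p).
Implicit Types (u v : H1 Omega) (lambda mu c : R).

Let p0 : 0 < p. Proof. by rewrite (lt_trans _ hp). Qed.

(** Young's inequality for t^2 * 1 with the conjugate exponents p/2 and
p/(p-2). *)
Lemma young_sqr (t : R) : 0 <= t -> t ^+ 2 / 2 - p^-1 * t `^ p <= 2^-1 - p^-1.
Proof.
move=> t0; have p2 : 0 < p - 2 by rewrite subr_gt0.
have pn0 : p != 0 by rewrite gt_eqF.
have p2n0 : p - 2 != 0 by rewrite gt_eqF.
have := @conjugate_powR R (t ^+ 2) 1 (p / 2) (p / (p - 2)) (sqr_ge0 t) ler01
  (divr_gt0 p0 (ltr0Sn _ 1)) (divr_gt0 p0 p2).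
have -> : (p / 2)^-1 + (p / (p - 2))^-1 = 1 by field; apply/andP; split.
move=> /(_ erefl); rewrite mulr1 powR1 -powR_mulrn// -powRrM.
rewrite (_ : 2 * (p / 2) = p); last by field.
rewrite powR_mulrn// (_ : t `^ p / (p / 2) + 1 / (p / (p - 2)) =
  2 * (p^-1 * t `^ p + (2^-1 - p^-1))); first lra.
by field; rewrite pn0 p2n0.
Qed.

Lemma nehari_norm_neq0 lambda v : nehari p lambda v -> Lq_norm Omega 2 v != 0.
Proof.
by case=> _ v0 _; apply/eqP => /(L2_norm_eq0 (H1_fun_L2 v)).
Qed.

Lemma Lq_norm_scale_pow c u : 0 <= c ->
  Lq_norm Omega p (scale_H1 c u) `^ p = c `^ p * Lq_norm Omega p u `^ p.
Proof. by move=> c0; rewrite Lq_norm_scale// powRM// Lq_norm_ge0. Qed.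

Lemma action_energy lambda v :
  action p lambda v = energy p v + lambda * (2^-1 * Lq_norm Omega 2 v ^+ 2).
Proof. by rewrite /action /energy; ring. Qed.

(** With P the L^p term of [v], the Nehari equation turns the action of [c v]
into P (c^2/2 - c^p/p). *)
Lemma nehari_action_max lambda v c : 0 <= c -> nehari p lambda v ->
  action p lambda (scale_H1 c v) <= action p lambda v.
Proof.
move=> c0 [_ _ nv]; rewrite /action grad_norm_scale// Lq_norm_scale//.
rewrite Lq_norm_scale_pow//.
move: nv; set A := grad_norm v; set B := Lq_norm Omega 2 v.
set P := Lq_norm Omega p v `^ p => nv.
have P0 : 0 <= P by exact: powR_ge0.
have -> : 2^-1 * (c * A) ^+ 2 + lambda / 2 * (c * B) ^+ 2 - p^-1 * (c `^ p * P) =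
  P * (c ^+ 2 / 2 - p^-1 * c `^ p) by rewrite -nv; ring.
have -> : 2^-1 * A ^+ 2 + lambda / 2 * B ^+ 2 - p^-1 * P = P * (2^-1 - p^-1).
  by rewrite -[in RHS]nv; rewrite -{1}nv; ring.
by apply: ler_wpM2l => //; exact: young_sqr.
Qed.

(** The competitor for the energy level is [v] rescaled to mass [mu]; for
[mu = 0] this is the zero function. *)
Lemma energy_le_action mu lambda v : 0 <= mu -> nehari p lambda v ->
  (energy_level Omega p mu + (lambda * mu)%:E <= (action p lambda v)%:E)%E.
Proof.
move=> mu0 nv; have v0 := nehari_norm_neq0 nv.
set B := Lq_norm Omega 2 v in v0.
have B2 : 0 < B ^+ 2 by rewrite lt_def sqr_ge0 sqrf_eq0 v0.
pose c := Num.sqrt (2 * mu / B ^+ 2).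
have c2 : c ^+ 2 = 2 * mu / B ^+ 2.
  by rewrite sqr_sqrtr//; apply: divr_ge0; [apply: mulr_ge0|exact: ltW].
have c0 : 0 <= c by exact: sqrtr_ge0.
have mass : 2^-1 * Lq_norm Omega 2 (scale_H1 c v) ^+ 2 = mu.
  by rewrite Lq_norm_scale// exprMn c2 -/B; field.
apply: (@le_trans _ _ ((energy p (scale_H1 c v))%:E + (lambda * mu)%:E)%E).
  apply: leeD => //; apply: ereal_inf_lbound; exists (scale_H1 c v) => //.
  by split => //; apply: scale_H10 => //; case: nv.
rewrite -EFinD lee_fin -{1}mass -action_energy.
exact: nehari_action_max.
Qed.

(** The Nehari equation of [v] solved for lambda. *)
Definition nehari_multiplier v : R :=
  (Lq_norm Omega p v `^ p - grad_norm v ^+ 2) / Lq_norm Omega 2 v ^+ 2.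

Lemma nehari_multiplierP v : H10 v -> Lq_norm Omega 2 v != 0 ->
  nehari p (nehari_multiplier v) v.
Proof.
move=> Hv v0; split => //.
  move=> v_ae; move/eqP: v0; apply; apply: Lq_norm_ae0 v_ae => //.
  exact: in_L2_measurable (H1_fun_L2 v).
by rewrite /nehari_multiplier; field.
Qed.

Lemma legendre_ge_action mu lambda v : nehari p lambda v ->
  ((lambda * mu - action p lambda v)%:E <=
   legendre_fenchel (@action_level R N Omega p) mu)%E.
Proof.
move=> nv; apply: (@le_trans _ _ ((lambda * mu)%:E - action_level Omega p lambda)%E).
  rewrite EFinB; apply: leeB => //; apply: ereal_inf_lbound.
  by exists v.
by apply: ereal_sup_ubound; exists lambda.
Qed.

(** Shrinking [u] moves it along Nehari manifolds on which its action tends to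
0, so some action levels lie below any given positive number. *)
Lemma legendre0_ge0 u : H10 u -> Lq_norm Omega 2 u != 0 ->
  (0 <= legendre_fenchel (@action_level R N Omega p) 0)%E.
Proof.
move=> Hu u0; apply/lee_addgt0Pr => e e0.
pose P := Lq_norm Omega p u `^ p; have P0 : 0 <= P by exact: powR_ge0.
have P1 : 0 < P + 1 by rewrite ltr_wpDl.
(* chosen so that c^p P <= e; the added 1 avoids dividing by P = 0 *)
pose c := (e / (P + 1)) `^ p^-1.
have c0 : 0 < c by apply: powR_gt0; exact: divr_gt0.
have cp : c `^ p = e / (P + 1).
  by rewrite -powRrM mulVf ?gt_eqF// powRr1// divr_ge0// ltW.
pose v := scale_H1 c u.
have Hv : H10 v by apply: scale_H10 => //; exact: ltW.
have v0 : Lq_norm Omega 2 v != 0.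
  by rewrite Lq_norm_scale ?(ltW c0)// mulf_neq0// gt_eqF.
have nv := nehari_multiplierP Hv v0.
have := legendre_ge_action 0 nv; rewrite mulr0 sub0r.
have le_e : action p (nehari_multiplier v) v <= e.
  case: (nv) => _ _ nvE; rewrite /action.
  have -> : 2^-1 * grad_norm v ^+ 2 + nehari_multiplier v / 2 *
      Lq_norm Omega 2 v ^+ 2 - p^-1 * Lq_norm Omega p v `^ p =
      (2^-1 - p^-1) * Lq_norm Omega p v `^ p.
    by rewrite -nvE; ring.
  have cP : c `^ p * P <= e.
    by rewrite cp mulrAC ler_pdivrMr// ler_pM2l// lerDl.
  rewrite Lq_norm_scale_pow ?(ltW c0)// -/P.
  have cP0 : 0 <= c `^ p * P by rewrite mulr_ge0 ?powR_ge0.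
  apply: le_trans cP; apply: ler_piMl => //.
  have : 0 < p^-1 by rewrite invr_gt0.
  lra.
move=> h; rewrite -leeBlDr// sub0e -EFinN; apply: le_trans h.
by rewrite lee_fin lerN2.
Qed.

(** A massless function vanishes almost everywhere, so its L^p term is 0,
and the gradient term is nonnegative. *)
Lemma energy_ge0_massless v : mass_constrained 0 v -> 0 <= energy p v.
Proof.
move=> [_ /eqP]; rewrite mulf_eq0 invr_eq0 pnatr_eq0/= sqrf_eq0 => /eqP v0.
have mv := in_L2_measurable (H1_fun_L2 v).
have vp := Lq_norm_ae0 p0 mv (L2_norm_eq0 (H1_fun_L2 v) v0).
by rewrite /energy vp powR0 ?gt_eqF// mulr0 subr0 mulr_ge0// sqr_ge0.
Qed.

End duality.

Theorem theorem1p2 (R : realType) (N : nat) (hN : (1 <= N)%N)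
    (Omega : set 'rV[R]_N) (hopen : open Omega) (hnonempty : Omega !=set0)
    (p : R) (hp : 2 < p) (hp' : (p%:E < critical_exponent R N)%E)
    (mu : R) (hmu : 0 <= mu) :
  (- energy_level Omega p mu)%E = legendre_fenchel (action_level Omega p) mu.
Proof.
apply/eqP; rewrite eq_le; apply/andP; split.
  rewrite leeNl; apply: le_ereal_inf_tmp => _ [v Mv <-]; rewrite leeNl.
  have [mu0|mu0] := eqVneq mu 0.
    rewrite mu0 in Mv *; have [u [Hu u0]] := exists_H10_neq0 hopen hnonempty.
    apply: le_trans (legendre0_ge0 hp Hu u0).
    by rewrite leeNl oppe0 lee_fin; exact: energy_ge0_massless hp _ Mv.
  case: Mv => Hv massv.
  have v0 : Lq_norm Omega 2 v != 0.
    by apply: contra_neq mu0 => v0; rewrite -massv v0 expr0n mulr0.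
  apply: le_trans (legendre_ge_action mu (@nehari_multiplierP _ _ _ p _ Hv v0)).
  by rewrite -EFinN lee_fin action_energy massv; lra.
apply: ge_ereal_sup => _ [lambda _ <-].
rewrite leeNr addeC fin_num_oppeD// oppeK leeBrDr//.
apply: le_ereal_inf_tmp => _ [v nv <-].
exact: energy_le_action.
Qed.
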